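(* Let $R$ be a ring and let $\{N_1,\dots,N_k\}$ be a collection of ideals of $R$ satisfying the CNC-condition, and let $s_i$ be the characteristic of $N_i$ in $N_{i+1}$ ($i=1,\dots,k-1$). Let $w$ be a natural number and $f\in R$ with $(f+N_1)^w = 1+N_1$ in $R/N_1$. Then $x^{w s_1 s_2\cdots s_{k-1}}=1$ for all $x\in f+N_1$. Moreover, if $w$ is the multiplicative order of $f+N_1$ in $R/N_1$, then the multiplicative order of every $x\in f+N_1$ divides $w s_1 s_2\cdots s_{k-1}$.
   Context: Rings are associative with identity, not necessarily commutative. The multiplicative order $o(x)$ of an element $x$ is the least natural number $m\ge 1$ with $x^m=1$ (if it exists). A collection $\{N_1,\dots,N_k\}$ of ideals of $R$ satisfies the CNC-condition if: (i) $\{0\}=N_k\subset N_{k-1}\subset\cdots\subset N_1\subset R$; (ii) for each $i=1,\dots,k-1$ there is $t_i\ge 2$ with $N_i^{t_i}\subset N_{i+1}$ (the minimal such $t_i$ is the nilpotency index of $N_i$ in $N_{i+1}$); (iii) for each $i=1,\dots,k-1$ there is $s_i\ge 1$ with $s_iN_i\subset N_{i+1}$ and all prime factors of $s_i$ are $\ge t_i$; the minimal such $s_i$ is called the characteristic of $N_i$ in $N_{i+1}$. *)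

(* Defs.v *)
From HB Require Import structures.
From mathcomp Require Import all_boot all_order all_algebra.
From mathcomp Require Import generic_quotient ring_quotient.
From mathcomp Require Import boolp classical_sets.

Set Implicit Arguments.
Unset Strict Implicit.
Unset Printing Implicit Defensive.

Import GRing.Theory.
Local Open Scope classical_set_scope.
Local Open Scope ring_scope.
Local Open Scope quotient_scope.

(* Two-sided ideals, possibly improper. The library's [idealr] are one-sided,
   decidable and proper, and are turned into ring quotients only over
   commutative rings. *)
Record ideal (R : pzRingType) := Ideal {
  ideal_set :> set R;
  ideal0 : ideal_set 0;
  idealB : forall x y, ideal_set x -> ideal_set y -> ideal_set (x - y);
  idealMl : forall a x, ideal_set x -> ideal_set (a * x);
  idealMr : forall a x, ideal_set x -> ideal_set (x * a)
}.

Section IdealQuotient.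
Variables (R : pzRingType) (I : ideal R).

Definition ideal_pred : {pred R} := fun x => `[< ideal_set I x >].

Lemma ideal_predP x : reflect (ideal_set I x) (x \in ideal_pred).
Proof. exact: asboolP. Qed.

Lemma ideal_pred_zmod : zmod_closed ideal_pred.
Proof.
split=> [|x y /ideal_predP Ix /ideal_predP Iy]; apply/ideal_predP.
  exact: ideal0.
exact: idealB.
Qed.

HB.instance Definition _ :=
  GRing.isZmodClosed.Build R ideal_pred ideal_pred_zmod.

(* The additive structure of R / I is the library's quotient of a Z-module. *)
Local Notation zquot := (Quotient.quot (ideal_pred : zmodClosed R)).

Definition ideal_quotient : Type := zquot.

HB.instance Definition _ := GRing.Zmodule.on ideal_quotient.

Definition residue (x : R) : ideal_quotient := \pi_zquot x.

Definition quotient_repr (u : ideal_quotient) : R := repr (u : zquot).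

Lemma quotient_reprK : cancel quotient_repr residue.
Proof. by move=> u; exact: reprK. Qed.

Lemma residue_eqP x y : residue x = residue y <-> ideal_set I (x - y).
Proof.
have E := Quotient.idealrBE (ideal_pred : zmodClosed R) x y.
split=> [exy|Ixy]; first by apply/ideal_predP; rewrite E; exact/eqP.
by apply/eqP; rewrite -[_ == _]E; exact/ideal_predP.
Qed.

Lemma residue_is_zmod_morphism : zmod_morphism residue.
Proof. exact: (@pi_is_zmod_morphism _ _ _ zquot). Qed.

HB.instance Definition _ :=
  GRing.isZmodMorphism.Build R ideal_quotient residue residue_is_zmod_morphism.

Definition quotient_mul (u v : ideal_quotient) : ideal_quotient :=
  residue (quotient_repr u * quotient_repr v).

Lemma residueM : {morph residue : x y / x * y >-> quotient_mul x y}.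
Proof.
move=> x y; apply/residue_eqP.
have repr_res z : ideal_set I (z - quotient_repr (residue z)).
  by apply/residue_eqP; rewrite quotient_reprK.
set x' := quotient_repr _; set y' := quotient_repr _.
have -> : x * y - x' * y' = x * (y - y') - - ((x - x') * y').
  by rewrite opprK mulrBr mulrBl addrA subrK.
apply: idealB; first exact/idealMl/repr_res.
by rewrite -mulNr; apply: idealMr; rewrite -sub0r; apply: idealB;
  [exact: ideal0|exact: repr_res].
Qed.

Lemma quotient_mulA : associative quotient_mul.
Proof.
by move=> u v z; rewrite -[u]quotient_reprK -[v]quotient_reprK
  -[z]quotient_reprK -!residueM mulrA.
Qed.

Lemma quotient_mul1 : left_id (residue 1) quotient_mul.
Proof. by move=> u; rewrite -[u]quotient_reprK -!residueM mul1r. Qed.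

Lemma quotient_mulr1 : right_id (residue 1) quotient_mul.
Proof. by move=> u; rewrite -[u]quotient_reprK -!residueM mulr1. Qed.

Lemma quotient_mulDl : left_distributive quotient_mul +%R.
Proof.
move=> u v z; rewrite -[u]quotient_reprK -[v]quotient_reprK.
by rewrite -[z]quotient_reprK -raddfD -!residueM -raddfD mulrDl.
Qed.

Lemma quotient_mulDr : right_distributive quotient_mul +%R.
Proof.
move=> u v z; rewrite -[u]quotient_reprK -[v]quotient_reprK.
by rewrite -[z]quotient_reprK -raddfD -!residueM -raddfD mulrDr.
Qed.

HB.instance Definition _ := GRing.Zmodule_isPzRing.Build ideal_quotient
  quotient_mulA quotient_mul1 quotient_mulr1 quotient_mulDl quotient_mulDr.

Lemma residue_is_monoid_morphism : monoid_morphism residue.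
Proof. by split=> // x y; exact: residueM. Qed.

HB.instance Definition _ :=
  GRing.isMonoidMorphism.Build R ideal_quotient residue
    residue_is_monoid_morphism.

Definition ideal_coset (f : R) : set R := [set f + y | y in (I : set R)].

(* I ^ t: finite sums of products of t elements of I (meaningful for t >= 1). *)
Definition ideal_exp (t : nat) : set R :=
  [set x | exists (m : nat) (a : 'I_m -> 'I_t -> R),
     (forall i j, ideal_set I (a i j)) /\
     x = \sum_(i < m) \prod_(j < t) a i j].

Definition ideal_muln (s : nat) : set R := [set x *+ s | x in (I : set R)].

End IdealQuotient.

Definition is_least (P : nat -> Prop) (m : nat) : Prop :=
  P m /\ forall n, P n -> (m <= n)%N.

Definition is_mult_order (R : pzRingType) (x : R) : nat -> Prop :=
  is_least (fun m => (1 <= m)%N /\ x ^+ m = 1).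

Section CNC.
Variable R : pzRingType.
Implicit Types N M : ideal R.

Definition nilpotency_exponent N M (t : nat) : Prop :=
  (2 <= t)%N /\ ideal_exp N t `<=` M.

Definition is_nilpotency_index N M : nat -> Prop :=
  is_least (nilpotency_exponent N M).

Definition char_exponent N M (s : nat) : Prop :=
  [/\ (1 <= s)%N, ideal_muln N s `<=` M &
      exists2 t, is_nilpotency_index N M t &
        forall p, prime p -> (p %| s)%N -> (t <= p)%N].

Definition is_characteristic N M : nat -> Prop := is_least (char_exponent N M).

(* Only the ideals N 1, ..., N k matter. Inclusions are not required to be
   strict. *)
Record CNC (k : nat) (N : nat -> ideal R) : Prop := {
  CNC_size : (1 <= k)%N;
  CNC_last : N k = [set 0] :> set R;
  CNC_chain : forall i, (1 <= i < k)%N -> N i.+1 `<=` N i;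
  CNC_nilp : forall i, (1 <= i < k)%N ->
    exists t, nilpotency_exponent (N i) (N i.+1) t;
  CNC_char : forall i, (1 <= i < k)%N ->
    exists s, char_exponent (N i) (N i.+1) s
}.

End CNC.

(* Main.v *)
Require Import Defs.
From HB Require Import structures.
From mathcomp Require Import all_boot all_order all_algebra.
From mathcomp Require Import boolp classical_sets.

Set Implicit Arguments.
Unset Strict Implicit.
Unset Printing Implicit Defensive.

Import GRing.Theory.
Local Open Scope classical_set_scope.
Local Open Scope ring_scope.

(** If [y = 1 + n] with [n] in [N i], then in the binomial expansion of
    [y ^+ s i - 1] the terms of degree at least [t i] lie in [N i.+1] by
    nilpotency, while for [0 < j < t i] the number [j] is coprime to [s i]
    (whose prime factors are at least [t i]), so that [s i] divides
    ['C(s i, j)] and the term of degree [j] lies in [s i N i].  Hence raising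
    to the power [s i] moves [1 + N i] into [1 + N i.+1]; starting from
    [x ^+ w] in [1 + N 1], one ends in [1 + N k = {1}]. *)

(** By [j * 'C(s, j) = s * 'C(s.-1, j.-1)], [s] divides the left side; Gauss's lemma removes the
    factor [j]. *)
Lemma dvdn_bin_coprime (s j : nat) : (0 < j)%N -> coprime s j ->
  (s %| 'C(s, j))%N.
Proof.
case: s j => [|s] [|j] // _ cosj.
by rewrite -(Gauss_dvdr _ cosj) -mul_bin_diag dvdn_mulr.
Qed.

(** A prime [p] dividing both [s] and [j] would give [t <= p <= j < t]. *)
Lemma coprime_lt_prime_divisors (s t j : nat) :
  (0 < j < t)%N -> (forall p, prime p -> (p %| s)%N -> (t <= p)%N) ->
  coprime s j.
Proof.
move=> /andP[j_gt0 ltjt] primes_ge; apply: contraLR ltjt => ncop.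
have gcd_gt1 : (1 < gcdn s j)%N.
  by rewrite ltn_neqAle eq_sym ncop gcdn_gt0 j_gt0 orbT.
have := pdiv_dvd (gcdn s j); rewrite dvdn_gcd => /andP[p_s p_j].
rewrite -leqNgt (leq_trans (primes_ge _ (pdiv_prime gcd_gt1) p_s)) //.
exact: dvdn_leq.
Qed.

Lemma ideal_exprn (R : pzRingType) (N : ideal R) (n : R) (t : nat) :
  ideal_set N n -> ideal_exp N t (n ^+ t).
Proof.
move=> Nn; exists 1%N, (fun _ _ => n); split=> //.
by rewrite big_ord1 prodr_const card_ord.
Qed.

Lemma char_exponent_expr (R : pzRingType) (N M : ideal R) (s : nat) (y : R) :
  char_exponent N M s -> ideal_set N (y - 1) -> ideal_set M (y ^+ s - 1).
Proof.
move=> [_ sNM [t [[t_ge2 NtM] _] primes_ge]]; set n := y - 1 => Nn.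
have -> : y = 1 + n by rewrite addrC subrK.
rewrite exprDn_comm; last exact: commr_sym (commr1 n).
rewrite big_ord_recl bin0 expr1n mul1r expr0 mulr1n addrC addrA addNr add0r.
(* The degree 0 term has cancelled against [- 1], so the summand of index [j] has degree [j.+1]. *)
apply/ideal_predP/rpred_sum => j _; rewrite lift0 expr1n mul1r.
have [letj|ltjt] := leqP t j.+1.
  apply/rpredMn/ideal_predP; rewrite -(subnK letj) exprD.
  exact/idealMl/NtM/ideal_exprn.
have /dvdnP[c ->] := dvdn_bin_coprime (ltn0Sn j)
  (coprime_lt_prime_divisors (j := j.+1) ltjt primes_ge).
rewrite mulnC mulrnA; apply/rpredMn/ideal_predP/sNM.
by exists (n ^+ j.+1) => //; rewrite exprSr; exact: idealMl.
Qed.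

Lemma is_mult_order_dvdn (R : pzRingType) (x : R) (e : nat) :
  (0 < e)%N -> x ^+ e = 1 -> exists2 m, is_mult_order x m & (m %| e)%N.
Proof.
move=> e_gt0 xe1.
have exP : exists m, (0 < m)%N && (x ^+ m == 1).
  by exists e; rewrite e_gt0 xe1 eqxx.
case: (ex_minnP exP) => m /andP[m_gt0 /eqP xm1] m_min; exists m.
  by split=> // n [n_gt0 xn1]; apply: m_min; rewrite n_gt0 xn1 eqxx.
(* A nonzero remainder [e %% m] would be a positive exponent below [m] killing [x], against
   minimality. *)
rewrite /dvdn; apply: contraTT (ltn_pmod e m_gt0) => r_neq0.
rewrite -leqNgt; apply: m_min; rewrite lt0n r_neq0 /=.
by move: xe1; rewrite {1}(divn_eq e m) exprD mulnC exprM xm1 expr1n mul1r => ->.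
Qed.

Theorem theorem3p1 (R : pzRingType) (k : nat) (N : nat -> ideal R)
  (hN : CNC k N) (s : nat -> nat)
  (hs : forall i, (1 <= i < k)%N -> is_characteristic (N i) (N i.+1) (s i))
  (w : nat) (f : R) (hf : residue (N 1%N) f ^+ w = 1) :
  (forall x : R, ideal_coset (N 1%N) f x ->
     x ^+ (w * \prod_(1 <= i < k) s i)%N = 1) /\
  (is_mult_order (residue (N 1%N) f) w ->
   forall x : R, ideal_coset (N 1%N) f x ->
     exists2 m, is_mult_order x m & (m %| w * \prod_(1 <= i < k) s i)%N).
Proof.
have k_gt0 := CNC_size hN.
have expr_eq1 x : ideal_coset (N 1%N) f x ->
    x ^+ (w * \prod_(1 <= i < k) s i)%N = 1.
  case=> y Ny <-; set z := f + y.
  have zw1 : ideal_set (N 1%N) (z ^+ w - 1).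
    apply/residue_eqP; rewrite rmorphXn rmorph1 -hf; congr (_ ^+ _).
    by apply/residue_eqP; rewrite addrC addrA addNr add0r.
  (* At [j = 1] the product is empty and this is [zw1]; each step appends the factor [s j]. *)
  have chain j : (0 < j <= k)%N ->
      ideal_set (N j) (z ^+ (w * \prod_(1 <= i < j) s i)%N - 1).
    elim: j => // -[_ _|j IHj /= ltjk]; first by rewrite big_geq // muln1.
    rewrite big_nat_recr //= mulnA exprM.
    apply: char_exponent_expr (IHj (ltnW ltjk)).
    by have [] := hs j.+1 ltjk.
  have := chain k; rewrite k_gt0 leqnn (CNC_last hN) => /(_ isT) /= /eqP.
  by rewrite subr_eq0 => /eqP.
(* An order exists once the exponent is positive: [w] is, being an order, and each [s i] is, being a
   characteristic. *)
split=> // -[[w_gt0 _] _] x fx; apply: is_mult_order_dvdn (expr_eq1 x fx).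
rewrite muln_gt0 w_gt0 big_nat_cond; apply: prodn_cond_gt0 => i.
by rewrite andbT => /hs[[]].
Qed.
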